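(* Let $A\in\mathbb{R}^{n\times n}$ be stable and $b\in\mathbb{R}^{n}$. Let $\mu_1,\ldots,\mu_N\in\mathbb{C}$ have positive real part and let $\alpha_j=-\mu_j^{-1}$ for $j=1,\ldots,N$ (so $\alpha_j$ has negative real part). Let $W_0=b$ and $W_j,V_j$, $j=1,\ldots,N$, be determined by the low rank ADI iteration with parameters $\alpha_1,\ldots,\alpha_N$, and let $h_0=b$ and $h_j,\mathcal{H}_j$, $j=1,\ldots,N$, be determined by the $1$-stage Runge-Kutta iteration with parameters $\mu_1,\ldots,\mu_N$ (both iterations are described in the context). Then there are constants $c_j,d_j\in\mathbb{C}$ with $|c_j|=|d_j|=1$ such that $$W_j=c_jh_j\qquad\text{and}\qquad \sqrt{-2\operatorname{Re}(\alpha_j)}\,V_j=d_j\sqrt{2\operatorname{Re}(\mu_j)}\,\mathcal{H}_j .$$ Thus the approximation $Z_jZ_j^{\mathsf H}$ to the solution $\mathcal{P}$ of $A\mathcal{P}+\mathcal{P}A^{\mathsf T}+bb^{\mathsf T}=0$ is the same in every step $j=1,\ldots,N$ of both iterations.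
   Context: A real square matrix is stable if all its eigenvalues have negative real part. $X^{\mathsf H}$ denotes the conjugate transpose. Low rank ADI iteration with parameters $\alpha_1,\ldots,\alpha_N$ of negative real part: set $W_0=b$ and let $Z_0$ be the empty matrix. For $j=1,\ldots,N$: let $V_j$ be the solution of $(A+\alpha_jI_n)V_j=W_{j-1}$; $W_j=W_{j-1}-2\operatorname{Re}(\alpha_j)V_j$; $Z_j=[Z_{j-1},\ \sqrt{-2\operatorname{Re}(\alpha_j)}\,V_j]$. $1$-stage Runge-Kutta iteration with parameters $\mu_1,\ldots,\mu_N$ of positive real part: set $h_0=b$ and let $Z_0$ be the empty matrix. For $j=1,\ldots,N$: let $K_j\in\mathbb{C}^{n}$ be the solution of $(I_n-\mu_jA)K_j=Ah_{j-1}$; $\mathcal{H}_j=h_{j-1}+\mu_jK_j$; $Z_j=[Z_{j-1},\ \sqrt{2\operatorname{Re}(\mu_j)}\,\mathcal{H}_j]$; $h_j=h_{j-1}+2\operatorname{Re}(\mu_j)K_j$. The matrices $Z_j$ of the two iterations are separate objects; the last assertion of the claim compares the products $Z_jZ_j^{\mathsf H}$. *)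

(* Defs.v *)
From mathcomp Require Export all_boot all_order all_algebra.
From mathcomp Require Export sesquilinear spectral.
From mathcomp Require Export reals.
From mathcomp Require Export complex.

Set Implicit Arguments.
Unset Strict Implicit.
Unset Printing Implicit Defensive.

Import Order.TTheory GRing.Theory Num.Theory.

Local Open Scope ring_scope.
Local Open Scope complex_scope.

Definition to_complex (R : realType) (m n : nat) (M : 'M[R]_(m, n)) :
    'M[R[i]]_(m, n) :=
  map_mx (real_complex R) M.

Definition stable (R : realType) (n : nat) (A : 'M[R]_n) : Prop :=
  forall lambda : R[i], eigenvalue (to_complex A) lambda ->
    complex.Re lambda < 0.

(* [Z, v]; the cast only turns the width j + 1 into j.+1. *)
Definition append_col (T : Type) (n j : nat) (Z : 'M[T]_(n, j)) (v : 'cV[T]_n) :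
    'M[T]_(n, j.+1) :=
  castmx (erefl n, addn1 j) (row_mx Z v).

(* The entries alpha 0 and V 0 play no role: both sequences start at index 1.
   The initial Z 0 has type 'M_(n, 0), hence is the empty matrix. *)
Definition low_rank_ADI (R : realType) (n : nat) (A : 'M[R]_n) (b : 'cV[R]_n)
    (N : nat) (alpha : nat -> R[i]) (W V : nat -> 'cV[R[i]]_n)
    (Z : forall j : nat, 'M[R[i]]_(n, j)) : Prop :=
  W 0%N = to_complex b /\
  forall j : nat, (j < N)%N ->
    [/\ (to_complex A + (alpha j.+1)%:M) *m V j.+1 = W j,
        W j.+1 = W j - (2 * complex.Re (alpha j.+1))%:C *: V j.+1
      & Z j.+1 = append_col (Z j)
          ((Num.sqrt (- 2 * complex.Re (alpha j.+1)))%:C *: V j.+1)].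

(* Same indexing as above; calH j is the internal stage value, h j the
   iterate. *)
Definition one_stage_RK (R : realType) (n : nat) (A : 'M[R]_n) (b : 'cV[R]_n)
    (N : nat) (mu : nat -> R[i]) (h K calH : nat -> 'cV[R[i]]_n)
    (Z : forall j : nat, 'M[R[i]]_(n, j)) : Prop :=
  h 0%N = to_complex b /\
  forall j : nat, (j < N)%N ->
    [/\ (1%:M - mu j.+1 *: to_complex A) *m K j.+1 = to_complex A *m h j,
        calH j.+1 = h j + mu j.+1 *: K j.+1,
        Z j.+1 = append_col (Z j)
          ((Num.sqrt (2 * complex.Re (mu j.+1)))%:C *: calH j.+1)
      & h j.+1 = h j + (2 * complex.Re (mu j.+1))%:C *: K j.+1].

(* Main.v *)
(* Both methods apply the resolvent (1 - mu_j A)^-1 once per step: if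
   W_(j-1) = c h_(j-1), then V_j = - mu_j c calH_j, because
   calH_j = (1 - mu_j A)^-1 h_(j-1).  Since
   2 Re mu_j = mu_j + conj mu_j, this gives
   W_j = - (mu_j / conj mu_j) c h_j.  The columns appended to the two low-rank
   factors therefore differ by a phase, which cancels in Z Z^H. *)

Require Import Defs.
From mathcomp Require Import ring.

Set Implicit Arguments.
Unset Strict Implicit.
Unset Printing Implicit Defensive.

Import Order.TTheory GRing.Theory Num.Theory.

Local Open Scope ring_scope.
Local Open Scope complex_scope.
Local Open Scope sesquilinear_scope.

Lemma Re_gt0_neq0 (R : realType) (z : R[i]) : 0 < complex.Re z -> z != 0.
Proof. by move=> z_gt0; apply: contraTneq z_gt0 => ->; rewrite ltxx. Qed.

Lemma Re_inv (R : realType) (z : R[i]) :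
  complex.Re z^-1 = complex.Re z / (complex.Re z ^+ 2 + complex.Im z ^+ 2).
Proof. by case: z. Qed.

(** Twice a real part is a number plus its conjugate. Removing [Re] in this way leaves a rational
    expression in [z] and its conjugate, the form matched by [ADI_residual]. *)
Lemma Re_inv_conj (R : realType) (z : R[i]) : z != 0 ->
  (2 * complex.Re (- z^-1))%:C = - ((z + z^*) / (z * z^*)).
Proof.
move=> z_neq0; have zJ_neq0 : z^* != 0 by rewrite conjc_eq0.
rewrite rmorphM /= rmorph_nat -addcJ rmorphN /= conjc_inv.
by field; apply/andP.
Qed.

(** The real part of [z^-1] is that of [z] divided by the squared modulus, which leaves the square
    root as a factor [|z|]. *)
Lemma sqrt_Re_inv (R : realType) (z : R[i]) : 0 < complex.Re z ->
  (Num.sqrt (- 2 * complex.Re (- z^-1)))%:C =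
  (Num.sqrt (2 * complex.Re z))%:C / `|z|.
Proof.
move=> z_gt0; rewrite normc_def -fmorphV -rmorphM /=; congr _%:C.
rewrite raddfN /= mulrNN Re_inv mulrA sqrtrM; last by rewrite mulr_ge0 // ltW.
by rewrite sqrtrV // addr_ge0 ?sqr_ge0.
Qed.

(** Were the matrix singular, [mu^-1] would be an eigenvalue of [A]; but its real part has the sign
    of that of [mu], against stability. *)
Lemma stable_resolvent (R : realType) (n : nat) (A : 'M[R]_n) (mu : R[i]) :
  stable A -> 0 < complex.Re mu -> 1%:M - mu *: to_complex A \in unitmx.
Proof.
move=> stableA mu_gt0; have mu_neq0 := Re_gt0_neq0 mu_gt0.
have -> : 1%:M - mu *: to_complex A = - mu *: (to_complex A - mu^-1%:M).
  by rewrite scalerBr !scaleNr scale_scalar_mx mulfV // opprK addrC.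
rewrite unitmxZ ?unitfE ?oppr_eq0 // -row_free_unit -kermx_eq0.
apply/negPn/negP => /stableA; rewrite Re_inv ltNge => /negP; apply.
by rewrite divr_ge0 ?addr_ge0 ?sqr_ge0 // ltW.
Qed.

Section Step.

Variables (F : fieldType) (n : nat) (A : 'M[F]_n) (m m' c : F).
Variables h k : 'cV[F]_n.
Hypotheses (m_neq0 : m != 0) (unitM : 1%:M - m *: A \in unitmx).
Hypothesis kE : (1%:M - m *: A) *m k = A *m h.

(** Scaling the ADI equation by [- m] turns its matrix into [1 - m A]. By [kE], this invertible
    matrix sends [h + m k] to [h], so both sides have the same image. *)
Lemma ADI_stage (v : 'cV[F]_n) :
  (A + (- m^-1)%:M) *m v = c *: h -> v = - (m * c) *: (h + m *: k).
Proof.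
move=> vE; apply: (can_inj (mulKmx unitM)).
have -> : (1%:M - m *: A) *m v = - (m * c) *: h.
  rewrite -mulNr -scalerA -vE scalemxAl scalerDr scale_scalar_mx mulrNN mulfV //.
  by rewrite scaleNr addrC.
rewrite -scalemxAr mulmxDr -scalemxAr kE mulmxBl mul1mx -scalemxAl.
by rewrite subrK.
Qed.

(** Here [m'] stands for the conjugate of [m]; the identity is purely algebraic, with [m] and [m']
    independent. *)
Lemma ADI_residual (v : 'cV[F]_n) : m' != 0 ->
  (A + (- m^-1)%:M) *m v = c *: h ->
  c *: h + ((m + m') / (m * m')) *: v = - (c * (m / m')) *: (h + (m + m') *: k).
Proof.
move=> m'_neq0 /ADI_stage ->; apply/matrixP=> i j; rewrite !mxE.
by field; apply/andP.
Qed.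

End Step.

Lemma append_col_gram (C : numClosedFieldType) (n j : nat)
    (Z : 'M[C]_(n, j)) (v : 'cV[C]_n) :
  append_col Z v *m (append_col Z v)^t* = Z *m Z^t* + v *m v^t*.
Proof.
rewrite /append_col; case: _ / (addn1 j); rewrite castmx_id.
by rewrite tr_row_mx map_col_mx mul_row_col.
Qed.

Lemma gram_phase (C : numClosedFieldType) (m n : nat) (d : C)
    (v : 'M[C]_(m, n)) : `|d| = 1 -> (d *: v) *m (d *: v)^t* = v *m v^t*.
Proof.
move=> d1; rewrite linearZ /= map_mxZ -scalemxAl -scalemxAr scalerA.
by rewrite -normCK d1 expr1n scale1r.
Qed.

Theorem theorem3 (R : realType) (n : nat) (A : 'M[R]_n) (b : 'cV[R]_n)
    (N : nat) (mu alpha : nat -> R[i])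
    (W V : nat -> 'cV[R[i]]_n) (Zadi : forall j : nat, 'M[R[i]]_(n, j))
    (h K calH : nat -> 'cV[R[i]]_n) (Zrk : forall j : nat, 'M[R[i]]_(n, j))
    (stableA : stable A)
    (mu_pos : forall j : nat, (1 <= j <= N)%N -> 0 < complex.Re (mu j))
    (alphaE : forall j : nat, (1 <= j <= N)%N -> alpha j = - (mu j)^-1)
    (adi : low_rank_ADI A b N alpha W V Zadi)
    (rk : one_stage_RK A b N mu h K calH Zrk) :
  (exists c d : nat -> R[i],
    forall j : nat, (1 <= j <= N)%N ->
      [/\ `|c j| = 1,
          `|d j| = 1,
          W j = c j *: h j
        & (Num.sqrt (- 2 * complex.Re (alpha j)))%:C *: V j =
          d j *: ((Num.sqrt (2 * complex.Re (mu j)))%:C *: calH j)]) /\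
  (forall j : nat, (1 <= j <= N)%N ->
    Zadi j *m (Zadi j)^t* = Zrk j *m (Zrk j)^t*).
Proof.
case: adi rk => W0 adiS [h0 rkS].
(* Each step contributes one phase; the empty product at index 0 matches [W 0 = h 0]. *)
pose c j := \prod_(1 <= k < j.+1) - (mu k / (mu k)^*).
(* Stage [j] starts from [W j.-1], hence [c j.-1]. The factor [- mu j] comes from [ADI_stage], and
   the modulus from the ratio of the two square roots. *)
pose d j := - (c j.-1 * (mu j / `|mu j|)).
have c_recr j : c j.+1 = - (c j * (mu j.+1 / (mu j.+1)^*)).
  by rewrite /c big_nat_recr //= mulrN.
have c_norm j : (j <= N)%N -> `|c j| = 1.
  elim: j => [_|j IHj lt_jN]; first by rewrite /c big_geq // normr1.
  have mu_neq0 := Re_gt0_neq0 (mu_pos j.+1 lt_jN).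
  rewrite c_recr normrN normrM (IHj (ltnW lt_jN)) mul1r normf_div normcJ.
  by rewrite divff // normr_eq0.
have Wh j : (j <= N)%N -> W j = c j *: h j.
  elim: j => [_|j IHj lt_jN]; first by rewrite /c big_geq // scale1r W0 h0.
  have [VE -> _] := adiS j lt_jN; have [KE _ _ ->] := rkS j lt_jN.
  have mu_gt0 := mu_pos j.+1 lt_jN; have mu_neq0 := Re_gt0_neq0 mu_gt0.
  rewrite (IHj (ltnW lt_jN)) alphaE // in VE *.
  (* Both step lengths are now written through [mu j.+1] and its conjugate, so that [m'] can be
     instantiated by the latter. *)
  rewrite Re_inv_conj // scaleNr opprK c_recr rmorphM /= rmorph_nat -addcJ.
  apply: ADI_residual VE => //; first exact: stable_resolvent.
  by rewrite conjc_eq0.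
have stageE j : (j < N)%N ->
    `|d j.+1| = 1 /\
    (Num.sqrt (- 2 * complex.Re (alpha j.+1)))%:C *: V j.+1 =
    d j.+1 *: ((Num.sqrt (2 * complex.Re (mu j.+1)))%:C *: calH j.+1).
  move=> lt_jN; have mu_gt0 := mu_pos j.+1 lt_jN.
  have mu_neq0 := Re_gt0_neq0 mu_gt0.
  split.
    rewrite /d normrN normrM c_norm 1?ltnW // mul1r normf_div normr_id.
    by rewrite divff // normr_eq0.
  have [VE _ _] := adiS j lt_jN; have [KE -> _ _] := rkS j lt_jN.
  rewrite Wh 1?ltnW // alphaE // in VE *.
  rewrite (ADI_stage mu_neq0 (stable_resolvent stableA mu_gt0) KE VE).
  rewrite sqrt_Re_inv // !scalerA /d /=; congr (_ *: _).
  have: `|mu j.+1| != 0 by rewrite normr_eq0.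
  (* The scalar identity holds with any nonzero [r] in place of the modulus. *)
  by move: `|mu j.+1| => r r_neq0; field.
split.
  exists c, d => -[//|j] /= lt_jN; have [dj VH] := stageE j lt_jN.
  by split=> //; [exact: c_norm | exact: Wh].
(* Dropping the lower bound lets the induction start from the empty factors. Each step then adds a
   rank-one term [v v^H], in which the phase [d] cancels. *)
move=> j /andP[_]; elim: j => [_|j IHj lt_jN].
  by rewrite [Zadi _]thinmx0 [Zrk _]thinmx0.
have [_ _ ->] := adiS j lt_jN; have [_ _ -> _] := rkS j lt_jN.
have [dj ->] := stageE j lt_jN.
by rewrite !append_col_gram gram_phase // (IHj (ltnW lt_jN)).
Qed.
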